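(* Let $n\ge0$ be an integer, $\delta\ge0$, and let $(X_k)_{k\in\mathbb{N}}$ be a sequence of $(n,\delta)$-hyperbolic metric spaces $X_k=(X_k,d_k)$. Then every asymptotic subset and every asymptotic cone of $(X_k)$ is $(n,0)$-hyperbolic, and the asymptotic rank of $(X_k)$ is at most $n$. In particular, $\operatorname{asrk}(X)\le n$ for any $(n,\ast)$-hyperbolic space $X$.
   Context: Let $I_n=\{\pm1,\ldots,\pm(n+1)\}$. For $\delta\ge 0$, a metric space $(X,d)$ is $(n,\delta)$-hyperbolic if for every family $(x_i)_{i\in I_n}$ of points of $X$ there is a permutation $\alpha\ne-\mathrm{id}$ of $I_n$ with $\sum_{i\in I_n}d(x_i,x_{-i})\le\sum_{i\in I_n}d(x_i,x_{\alpha(i)})+2\delta$. $X$ is $(n,\ast)$-hyperbolic if it is $(n,\delta)$-hyperbolic for some $\delta\ge 0$. A compact metric space $Z$ is an asymptotic subset of a sequence $(X_k,d_k)_{k\in\mathbb{N}}$ of metric spaces if there are a sequence $0<r_k\to\infty$ and subsets $Z_k\subset X_k$ such that the rescaled sets $(Z_k,r_k^{-1}d_k)$ converge to $Z$ in the Gromov–Hausdorff topology. The asymptotic rank of $(X_k)$ is the supremum of all integers $m\ge0$ for which there exists an asymptotic subset of $(X_k)$ bi-Lipschitz homeomorphic to a compact subset of $\mathbb{R}^m$ with positive Lebesgue measure. $\operatorname{asrk}(X)$ is the asymptotic rank of the constant sequence $X_k=X$. An asymptotic cone of $(X_k)$ is an ultralimit, with respect to some non-principal ultrafilter on $\mathbb{N}$,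 of a sequence of pointed rescaled spaces $(X_k,r_k^{-1}d_k,p_k)$ with $p_k\in X_k$ and $0<r_k\to\infty$. *)

(* Defs.v *)
From HB Require Import structures.
From mathcomp Require Import all_boot all_order all_fingroup all_algebra.
From mathcomp Require Import generic_quotient.
From mathcomp Require Import all_classical all_reals all_analysis.

Set Implicit Arguments.
Unset Strict Implicit.
Unset Printing Implicit Defensive.

Import Order.TTheory GRing.Theory Num.Theory.
Import numFieldNormedType.Exports.

Local Open Scope classical_set_scope.
Local Open Scope ring_scope.

(* {±1, ..., ±(n+1)}: the pair (s, i) stands for i + 1 with sign given by s. *)
Definition signed_index (n : nat) : Type := (bool * 'I_n.+1)%type.
HB.instance Definition _ n := Finite.on (signed_index n).

Definition sopp n (i : signed_index n) : signed_index n := (~~ i.1, i.2).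

Lemma sopp_inj n : injective (@sopp n).
Proof. by apply: inv_inj => -[s i]; rewrite /sopp negbK. Qed.

Definition sopp_perm n : {perm signed_index n} := perm (@sopp_inj n).

Definition hyperbolic (R : realType) (n : nat) (delta : R) (X : metricType R) :=
  forall x : signed_index n -> X,
  exists2 alpha : {perm signed_index n}, alpha != sopp_perm n &
    \sum_i mdist (x i) (x (sopp i)) <=
    \sum_i mdist (x i) (x (alpha i)) + 2 * delta.

Definition star_hyperbolic (R : realType) (n : nat) (X : metricType R) :=
  exists2 delta : R, 0 <= delta & hyperbolic n delta X.

(* The metric space (X, r^-1 d). *)
Definition rescaled (R : realType) (r : {posnum R}) (X : metricType R) : Type :=
  X.

Section rescaled_metric.
Variables (R : realType) (r : {posnum R}) (X : metricType R).

HB.instance Definition _ := Choice.on (rescaled r X).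

Let d (x y : rescaled r X) : R := r%:num^-1 * mdist (x : X) (y : X).

Let dxx x : d x x = 0.
Proof. by rewrite /d mdistxx mulr0. Qed.

Let d_positivity x y : d x y = 0 -> x = y.
Proof.
move/eqP; rewrite /d mulf_eq0 invr_eq0 gt_eqF//= => /eqP.
exact: mdist_positivity.
Qed.

Let d_sym x y : d x y = d y x.
Proof. by rewrite /d metric_sym. Qed.

Let d_triangle y x z : d x z <= d x y + d y z.
Proof.
by rewrite /d -mulrDr ler_wpM2l ?invr_ge0//; exact: metric_triangle.
Qed.

HB.instance Definition _ :=
  isMetric.Build R (rescaled r X) dxx d_positivity d_sym d_triangle.

End rescaled_metric.

Section subset_metric.
Variables (R : realType) (X : metricType R) (A : set X).

Let d (x y : set_type A) : R := mdist (val x) (val y).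

Let d_ge0 x y : 0 <= d x y.
Proof. exact: mdist_ge0. Qed.

Let d_positivity x y : d x y = 0 -> x = y.
Proof. by move/mdist_positivity/val_inj. Qed.

Let ballEd (x : set_type A) e : ball x e = [set y | d x y < e].
Proof.
rewrite predeqE => y; change (ball (val x) e (val y) <-> d x y < e).
by rewrite ballEmdist.
Qed.

HB.instance Definition _ :=
  PseudoMetric_isMetric.Build R (set_type A) d_ge0 d_positivity ballEd.

End subset_metric.

Definition isometric (R : realType) (X Y : metricType R) (f : X -> Y) :=
  forall x y, mdist (f x) (f y) = mdist x y.

Definition hausdorff_dist (R : realType) (W : metricType R) (A B : set W)
    : \bar R :=
  ereal_inf [set e%:E | e in [set e : R | [/\ 0 < e,
    forall a, A a -> exists2 b, B b & mdist a b < e &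
    forall b, B b -> exists2 a, A a & mdist a b < e]]].

Definition gh_dist (R : realType) (X Y : metricType R) : \bar R :=
  ereal_inf [set h | exists (W : metricType R) (f : X -> W) (g : Y -> W),
    [/\ isometric f, isometric g & h = hausdorff_dist (range f) (range g)]].

Definition asymptotic_subset (R : realType) (X : nat -> metricType R)
    (Z : metricType R) :=
  compact [set: Z] /\
  exists (r : nat -> {posnum R}) (A : forall k, set (rescaled (r k) (X k))),
    (r k)%:num @[k --> \oo] --> +oo /\
    gh_dist (set_type (A k)) Z @[k --> \oo] --> 0%E.

Section lebesgue.
Variables (R : realType) (m : nat).
Implicit Types (a b x y : 'rV[R]_m) (A K : set 'rV[R]_m).

Definition euclidean_dist x y : R :=
  Num.sqrt (\sum_(i < m) (x ord0 i - y ord0 i) ^+ 2).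

Definition box a b : set 'rV[R]_m :=
  [set x | forall i, a ord0 i < x ord0 i <= b ord0 i].

Definition box_volume a b : R :=
  \prod_(i < m) Num.max 0 (b ord0 i - a ord0 i).

(* Lebesgue outer measure on R^m, which is Lebesgue measure on measurable sets,
   in particular on compact ones.  The predicate P allows finite covers; without
   it a point would have infinite measure when m = 0, since every box is then
   the whole space, of volume 1. *)
Definition lebesgue_outer_measure A : \bar R :=
  ereal_inf [set s | exists (P : pred nat) (a b : nat -> 'rV[R]_m),
    A `<=` \bigcup_(k in [set k | P k]) box (a k) (b k) /\
    s = (\sum_(k <oo | P k) (box_volume (a k) (b k))%:E)%E].

Definition bilipschitz_homeomorphic (Z : metricType R) K :=
  exists (f : Z -> 'rV[R]_m) (L : R),
    [/\ 0 < L, range f = K &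
        forall z w, L^-1 * mdist z w <= euclidean_dist (f z) (f w)
                    /\ euclidean_dist (f z) (f w) <= L * mdist z w].

End lebesgue.

(* The supremum is taken in the extended reals: it is +oo if the set of m is
   unbounded, and -oo if that set is empty, which only happens when X k is empty
   for infinitely many k. *)
Definition asymptotic_rank (R : realType) (X : nat -> metricType R) : \bar R :=
  ereal_sup [set m%:R%:E | m in [set m : nat |
    exists (Z : metricType R) (K : set 'rV[R]_m),
      [/\ asymptotic_subset X Z, compact K, (0 < lebesgue_outer_measure K)%E &
          bilipschitz_homeomorphic Z K]]].

Definition asrk (R : realType) (X : metricType R) : \bar R :=
  asymptotic_rank (fun=> X).

Section ultralimit.
Variables (R : realType) (F : set_system nat) (UF : UltraFilter F).
Variables (Y : nat -> metricType R) (p : forall k, Y k).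

Definition bounded_seq : Type :=
  {x : forall k, Y k | exists M : R, forall k, mdist (p k) (x k) <= M}.

HB.instance Definition _ := gen_eqMixin bounded_seq.
HB.instance Definition _ := gen_choiceMixin bounded_seq.

Definition ultra_dist (x y : bounded_seq) : R :=
  lim (mdist (sval x k) (sval y k) @[k --> F]).

Lemma ultra_dist_cvg (x y : bounded_seq) :
  mdist (sval x k) (sval y k) @[k --> F] --> ultra_dist x y.
Proof.
case: x y => [x [M xM]] [y [N yN]]; rewrite /ultra_dist/=.
pose G := mdist (x k) (y k) @[k --> F].
have GU : UltraFilter G.
  split=> [|H HF GH].
    exact: fmap_proper_filter.
  rewrite predeqE => A; split; last exact: GH.
  move=> HA; have [//|FnA] := in_ultra_setVsetC
    ((fun k => mdist (x k) (y k)) @^-1` A) UF.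
  have HnA : H (~` A) by exact: GH.
  by have [t []] := filter_ex (filterI HA HnA).
have GI : G [set` `[0, M + N]].
  rewrite /G /fmap /=; apply: (@filterE _ F) => k /=; rewrite in_itv/=.
  apply/andP; split; first exact: mdist_ge0.
  rewrite (le_trans (metric_triangle _ (p k) _))// lerD//.
  by rewrite metric_sym.
have := @segment_compact R 0 (M + N); rewrite compact_ultra.
by move=> /(_ G GU GI)[l [_ Gl]]; apply/cvg_ex; exists l.
Qed.

Lemma ultra_dist_refl x : ultra_dist x x = 0.
Proof.
rewrite /ultra_dist; under eq_fun do rewrite mdistxx.
exact: (@lim_cst _ (@Rhausdorff R)).
Qed.

Lemma ultra_dist_sym x y : ultra_dist x y = ultra_dist y x.
Proof.
by rewrite /ultra_dist; under eq_fun do rewrite metric_sym.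
Qed.

Lemma ultra_dist_triangle y x z :
  ultra_dist x z <= ultra_dist x y + ultra_dist y z.
Proof.
have xyz := cvgD (@ultra_dist_cvg x y) (@ultra_dist_cvg y z).
apply: (ler_cvg_to (@ultra_dist_cvg x z) (xyz _)).
by apply: (@filterE _ F) => k; exact: metric_triangle.
Qed.

Lemma ultra_dist_ge0 x y : 0 <= ultra_dist x y.
Proof.
apply: (ler_cvg_to (cvg_cst 0) (@ultra_dist_cvg x y)).
by apply: (@filterE _ F) => k; exact: mdist_ge0.
Qed.

Definition ultra_eq : rel bounded_seq := fun x y => ultra_dist x y == 0.

Lemma ultra_eq_refl : reflexive ultra_eq.
Proof. by move=> x; rewrite /ultra_eq ultra_dist_refl. Qed.

Lemma ultra_eq_sym : symmetric ultra_eq.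
Proof. by move=> x y; rewrite /ultra_eq ultra_dist_sym. Qed.

Lemma ultra_eq_trans : transitive ultra_eq.
Proof.
move=> y x z /eqP xy /eqP yz; rewrite /ultra_eq eq_le ultra_dist_ge0 andbT.
by rewrite (le_trans (ultra_dist_triangle y x z))// xy yz addr0.
Qed.

Canonical ultra_equiv :=
  EquivRel ultra_eq ultra_eq_refl ultra_eq_sym ultra_eq_trans.

Definition ultralimit : Type := {eq_quot ultra_equiv}%qT.

HB.instance Definition _ := Choice.on ultralimit.
HB.instance Definition _ := Quotient.on ultralimit.

Let d (u v : ultralimit) : R := ultra_dist (repr u) (repr v).

Let dxx u : d u u = 0.
Proof. exact: ultra_dist_refl. Qed.

Let d_positivity u v : d u v = 0 -> u = v.
Proof.
move=> uv; rewrite -[u]reprK -[v]reprK; apply/eqmodP.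
by rewrite /= /ultra_eq -/(d u v) uv.
Qed.

Let d_sym u v : d u v = d v u.
Proof. exact: ultra_dist_sym. Qed.

Let d_triangle v u w : d u w <= d u v + d v w.
Proof. exact: ultra_dist_triangle. Qed.

HB.instance Definition _ :=
  isMetric.Build R ultralimit dxx d_positivity d_sym d_triangle.

End ultralimit.

Definition asymptotic_cone (R : realType) (F : set_system nat)
    (UF : UltraFilter F) (X : nat -> metricType R) (r : nat -> {posnum R})
    (p : forall k, X k) : metricType R :=
  ultralimit UF (p : forall k, rescaled (r k) (X k)).
Arguments asymptotic_cone {R F} UF X r p.

(* Main.v *)
(* Hyperbolicity involves finitely many distances and finitely many
   permutations, so it passes to limits, with delta rescaled to 0.

   For the rank, let Z be an (n,0)-hyperbolic asymptotic subset that is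
   bi-Lipschitz to a compact K in R^m of positive measure, and suppose n < m.
   For each k some cube has all cells of its k^m-grid met by K: otherwise,
   iterating the subdivision covers K by cubes of total volume tending to 0.
   Rescaling these cubes gives a limit (n,0)-hyperbolic metric on all of R^m,
   bi-Lipschitz to the Euclidean one.  Instead of differentiating this metric
   almost everywhere, we use that the set of all such metrics is compact and
   invariant under translations and rescalings: maximising the speed in a given
   direction v and blowing up, we reach metrics for which all lines parallel to
   v are geodesics of the same speed.  Doing this for all rational directions v
   in turn, we obtain a norm.

   Finally a norm N on R^m is not (n,0)-hyperbolic.  If x maximises
   N(y) - |y - c|^2, then N is differentiable at x with gradient 2(x - c).
   This yields n + 1 points x_i whose gradients are nonzero and pairwise
   different up to sign.  As N(x + y) < N(x) + N(y) at points with different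
   gradients, -id is the only permutation maximising the sum of distances for
   the points x_i and -x_i. *)
Require Import Defs.
From mathcomp Require Import all_boot all_order all_fingroup all_algebra.
From mathcomp Require Import all_classical all_reals all_analysis.
From mathcomp Require Import ring lra.

Set Implicit Arguments.
Unset Strict Implicit.
Unset Printing Implicit Defensive.

Import Order.TTheory GRing.Theory Num.Theory.
Import numFieldNormedType.Exports.

Local Open Scope classical_set_scope.
Local Open Scope ring_scope.

(** * Limits of hyperbolic spaces *)

(** Phrased for arbitrary functions, since the limit metrics on R^m below are plain functions rather
    than instances of [metricType]. *)
Definition hyperbolic_fun (R : realType) (n : nat) (delta : R) (T : Type)
    (rho : T -> T -> R) :=
  forall x : signed_index n -> T,
  exists2 alpha : {perm signed_index n}, alpha != sopp_perm n &
    \sum_i rho (x i) (x (sopp i)) <=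
    \sum_i rho (x i) (x (alpha i)) + 2 * delta.

(** The permutation must not depend on the error, so [alpha] is chosen to maximise the sum for
    [sigma] among all permutations other than -id; then the error can tend to 0. *)
Lemma hyperbolic_fun_approx (R : realType) (n : nat) (S : Type)
    (sigma : S -> S -> R) :
  (forall (x : signed_index n -> S) (e : R), 0 < e ->
     exists (T : Type) (rho : T -> T -> R) (y : signed_index n -> T),
       hyperbolic_fun n e rho /\
       forall i j, `|rho (y i) (y j) - sigma (x i) (x j)| <= e) ->
  hyperbolic_fun n 0 sigma.
Proof.
move=> approx x; rewrite /= mulr0.
pose M (alpha : {perm signed_index n}) := \sum_i sigma (x i) (x (alpha i)).
have one_neq : (1%g : {perm signed_index n}) != sopp_perm n.
  apply/eqP => /permP/(_ (true, ord0)).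
  by rewrite perm1 permE.
have [alpha alphaN Mmax] := @arg_maxP _ _ _ _ [pred a | a != sopp_perm n] M one_neq.
exists alpha => //; rewrite addr0; apply/ler_addgt0Pr => e e0.
pose N : R := #|{: signed_index n}|%:R.
have N0 : 0 <= N by rewrite ler0n.
(* Each of the two sums of [N] terms costs [N * e'], and the hyperbolicity constant costs
   [2 * e']. *)
have e'0 : 0 < e / (2 * N + 2) by rewrite divr_gt0//; lra.
have [T [rho [y [hyp close]]]] := approx x _ e'0.
have {e'0} -> : e = (2 * N + 2) * (e / (2 * N + 2)).
  by rewrite mulrC divfK// gt_eqF//; lra.
set e' := e / _ in hyp close *.
have [beta betaN le_beta] := hyp y.
have sumN (c : R) : \sum_(i : signed_index n) c = N * c.
  by rewrite sumr_const mulr_natl.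
have le1 : \sum_i sigma (x i) (x (sopp i)) <=
           \sum_i rho (y i) (y (sopp i)) + N * e'.
  rewrite -sumN -big_split/=; apply: ler_sum => i _.
  by have := close i (sopp i); rewrite ler_norml; lra.
have le2 : \sum_i rho (y i) (y (beta i)) <= M beta + N * e'.
  rewrite -sumN -big_split/=; apply: ler_sum => i _.
  by have := close i (beta i); rewrite ler_norml; lra.
have le3 : M beta <= M alpha := Mmax _ betaN.
rewrite -/(M alpha); lra.
Qed.

Lemma hyperbolic_fun_cvg (R : realType) (n : nat) (I : Type)
    (F : set_system I) (FF : ProperFilter F) (T : I -> Type)
    (rho : forall k, T k -> T k -> R) (delta : I -> R)
    (S : Type) (sigma : S -> S -> R) :
  (\forall k \near F, hyperbolic_fun n (delta k) (rho k)) ->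
  delta k @[k --> F] --> 0 ->
  (forall x : signed_index n -> S, exists y : forall k, signed_index n -> T k,
     forall i j, rho k (y k i) (y k j) @[k --> F] --> sigma (x i) (x j)) ->
  hyperbolic_fun n 0 sigma.
Proof.
move=> hyp delta0 approx; apply: hyperbolic_fun_approx => x e e0.
have [y yx] := approx x.
have close : \forall k \near F, forall i j,
    `|rho k (y k i) (y k j) - sigma (x i) (x j)| <= e.
  apply: filter_forall => i; apply: filter_forall => j.
  by move/cvgr_distC_le: (yx i j); exact.
have deltae : \forall k \near F, `|delta k| <= e.
  by move/cvgr0_norm_le: delta0; exact.
have [k [[hypk deltak] closek]] := filter_ex (filterI (filterI hyp deltae) close).
exists (T k), (rho k), (y k); split=> // z.
have [alpha alphaN le_alpha] := hypk z; exists alpha => //.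
by rewrite (le_trans le_alpha)// lerD2l ler_pM2l// (le_trans (ler_norm _)).
Qed.

(** If a singleton were in [F], then [F] would lie in a principal filter and equal it by maximality;
    so [F] contains the complements of points. *)
Lemma nonprincipal_cofinite (F : set_system nat) (UF : UltraFilter F) :
  (forall k, F <> principal_filter k) -> \oo `<=` F.
Proof.
move=> Fnp.
have FC k : F (~` [set k]).
  have [Fk|//] := in_ultra_setVsetC [set k] UF.
  exfalso; apply: (Fnp k); apply/esym/max_filter => [|A FA].
    exact: principal_filter_proper.
  have [j [/= -> Aj]] := filter_ex (filterI Fk FA).
  exact/principal_filterP.
have FN N : F [set k | (N <= k)%N].
  elim: N => [|N IHN]; first by apply: filterE.
  apply: filterS (filterI IHN (FC N)) => k [/= Nk kN].
  by rewrite ltn_neqAle Nk andbT eq_sym; apply/eqP.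
by move=> A [N _ NA]; apply: filterS (FN N) => k; exact: NA.
Qed.

Lemma invr_cvg_pinfty (R : realType) (F : set_system nat) (FF : Filter F)
    (r : nat -> {posnum R}) :
  (r k)%:num @[k --> F] --> +oo -> (r k)%:num^-1 @[k --> F] --> 0.
Proof.
move=> roo; apply/cvgrPdist_lt => e e0; near=> k.
rewrite sub0r normrN ger0_norm// invf_plt ?posrE//.
near: k; move/cvgryPgt: roo; exact.
Unshelve. all: end_near. Qed.

Lemma rescaled_hyperbolic (R : realType) (n : nat) (delta : R)
    (X : metricType R) (r : {posnum R}) :
  hyperbolic n delta X -> hyperbolic n (r%:num^-1 * delta) (rescaled r X).
Proof.
move=> hyp x; have [alpha alphaN le_alpha] := hyp x; exists alpha => //.
by rewrite -!mulr_sumr mulrCA -mulrDr ler_wpM2l// invr_ge0.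
Qed.

Lemma subset_hyperbolic (R : realType) (n : nat) (delta : R)
    (X : metricType R) (A : set X) :
  hyperbolic n delta X -> hyperbolic n delta (set_type A).
Proof. by move=> hyp x; have := hyp (val \o x). Qed.

Lemma asymptotic_cone_hyperbolic (R : realType) (n : nat) (delta : R)
    (X : nat -> metricType R) (F : set_system nat) (UF : UltraFilter F)
    (r : nat -> {posnum R}) (p : forall k, X k) :
  (forall k, hyperbolic n delta (X k)) -> (forall k, F <> principal_filter k) ->
  (r k)%:num @[k --> \oo] --> +oo ->
  hyperbolic n 0 (asymptotic_cone UF X r p).
Proof.
move=> hyp Fnp roo.
apply: (@hyperbolic_fun_cvg _ _ _ F _ _
    (fun k => @mdist R (rescaled (r k) (X k)))
    (fun k => (r k)%:num^-1 * delta)).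
- by apply: filterE => k; exact: rescaled_hyperbolic.
- rewrite -[X in _ --> X](mul0r delta); apply: cvgMr_tmp.
  apply: invr_cvg_pinfty; apply: cvg_trans roo; apply: cvg_app.
  exact: nonprincipal_cofinite.
- move=> x.
  pose u i : bounded_seq (p : forall k, rescaled (r k) (X k)) :=
    generic_quotient.repr (x i).
  exists (fun k i => sval (u i) k) => i j.
  exact: (@ultra_dist_cvg _ _ UF _ _ (u i) (u j)).
Qed.

(** Send each point of [Y] to a point of [X] near it in the common ambient space; both endpoints
    move by less than [e]. *)
Lemma gh_dist_lt (R : realType) (X Y : metricType R) (e : R) :
  (gh_dist X Y < e%:E)%E ->
  exists f : Y -> X, forall y y', `|mdist (f y) (f y') - mdist y y'| <= 2 * e.
Proof.
move=> /ereal_inf_lt[_ [W [f [g [fi gi ->]]]]].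
move=> /ereal_inf_lt[_ [d [d0 _ gf] <-]]; rewrite lte_fin => de.
have /choice[h hP] y : exists x, mdist (f x) (g y) < d.
  by have [_ [x _ <-]] := gf _ (imageT g y); exists x.
exists h => y y'; rewrite -fi -gi.
have hy := hP y; have hy' := hP y'.
have t1 := metric_triangle (f (h y)) (g y) (f (h y')).
have t2 := metric_triangle (g y) (g y') (f (h y')).
have t3 := metric_triangle (g y) (f (h y)) (g y').
have t4 := metric_triangle (f (h y)) (f (h y')) (g y').
have s1 := metric_sym (g y) (f (h y)).
have s2 := metric_sym (g y') (f (h y')).
by rewrite ler_norml; lra.
Qed.

Lemma asymptotic_subset_hyperbolic (R : realType) (n : nat) (delta : R)
    (X : nat -> metricType R) (Z : metricType R) :
  (forall k, hyperbolic n delta (X k)) -> asymptotic_subset X Z ->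
  hyperbolic n 0 Z.
Proof.
move=> hyp [_ [r [A [roo AZ]]]].
apply: hyperbolic_fun_approx => x e e0.
have deltae : \forall k \near \oo, (r k)%:num^-1 * delta <= e.
  have : (r k)%:num^-1 * delta @[k --> \oo] --> 0.
    by rewrite -[X in _ --> X](mul0r delta); apply: cvgMr_tmp; exact: invr_cvg_pinfty.
  move/cvgr0_norm_le => /(_ _ e0); apply: filterS => k.
  by apply: le_trans; exact: ler_norm.
have e20 : (0 < (e / 2)%:E)%E by rewrite lte_fin divr_gt0.
have ghe : \forall k \near \oo, (gh_dist (set_type (A k)) Z < (e / 2)%:E)%E.
  exact: (AZ _ (open_ereal_lt' e20)).
have [k [deltak ghk]] := filter_ex (filterI deltae ghe).
have [f fP] := gh_dist_lt ghk.
exists (set_type (A k)), (@mdist R (set_type (A k))), (f \o x); split; last first.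
  by move=> i j; rewrite (le_trans (fP _ _))// mulrC divfK.
have := @subset_hyperbolic _ _ _ _ (A k) (@rescaled_hyperbolic _ _ _ _ (r k) (hyp k)).
move=> hypk z; have [alpha alphaN le_alpha] := hypk z; exists alpha => //.
by rewrite (le_trans le_alpha)// lerD2l ler_pM2l.
Qed.

(** * Bounded limits along ultrafilters and the Euclidean distance *)

(** The image of an ultrafilter is an ultrafilter; this one contains the compact interval [-M, M],
    hence converges. *)
Lemma ultra_bounded_cvg (R : realType) (I : Type) (F : set_system I)
    (UF : UltraFilter F) (u : I -> R) (M : R) :
  (\forall k \near F, `|u k| <= M) -> u k @[k --> F] --> lim (u k @[k --> F]).
Proof.
move=> uM; pose G : set_system R := u k @[k --> F].
have GU : UltraFilter G.
  split=> [|H HF GH]; first exact: fmap_proper_filter.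
  rewrite predeqE => A; split=> [HA|]; last exact: GH.
  have [//|FnA] := in_ultra_setVsetC (u @^-1` A) UF.
  by have [t []] := filter_ex (filterI HA (GH (~` A) FnA)).
have GI : G [set` `[- M, M]].
  by apply: filterS uM => k; rewrite /= in_itv/= ler_norml.
have := @segment_compact R (- M) M; rewrite compact_ultra.
by move=> /(_ G GU GI)[l [_ Gl]]; apply/cvg_ex; exists l.
Qed.

Lemma euclidean_distxx (R : realType) (m : nat) (x : 'rV[R]_m) :
  euclidean_dist x x = 0.
Proof.
by rewrite /euclidean_dist big1 ?sqrtr0// => i _; rewrite subrr expr0n.
Qed.

Lemma euclidean_dist_affine (R : realType) (m : nat) (t : R) (z x y : 'rV[R]_m) :
  euclidean_dist (z + t *: x) (z + t *: y) = `|t| * euclidean_dist x y.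
Proof.
rewrite /euclidean_dist -sqrtr_sqr -sqrtrM ?sqr_ge0// mulr_sumr.
by congr Num.sqrt; apply: eq_bigr => i _; rewrite !mxE; ring.
Qed.

Lemma euclidean_dist_le (R : realType) (m : nat) (x y : 'rV[R]_m) (d : R) :
  0 <= d -> (forall i, `|x ord0 i - y ord0 i| <= d) ->
  euclidean_dist x y <= m%:R * d.
Proof.
move=> d0 xyd; have md0 : 0 <= m%:R * d by rewrite mulr_ge0.
rewrite /euclidean_dist -(ger0_norm md0) -sqrtr_sqr ler_wsqrtr//.
apply: (@le_trans _ _ (\sum_(i < m) d ^+ 2)).
  apply: ler_sum => i _; rewrite -real_normK ?num_real//.
  by rewrite ler_pXn2r// nnegrE.
rewrite sumr_const card_ord -[_ ^+ 2 *+ m]mulr_natl exprMn ler_wpM2r ?sqr_ge0//.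
(* The sum of squares is at most m d^2, and m <= m^2 for natural m. *)
by rewrite -natrX ler_nat; case: (m) => // k; rewrite expnS leq_pmulr.
Qed.

Lemma rat_row_dense (R : realType) (m : nat) (x : 'rV[R]_m) (eps : R) :
  0 < eps -> exists q : 'rV[rat]_m, euclidean_dist (map_mx ratr q) x <= eps.
Proof.
(* [m.+1] keeps the denominator nonzero when m = 0. *)
move=> eps0; pose d := eps / m.+1%:R; have d0 : 0 < d by rewrite divr_gt0.
have /choice[q qP] i : exists q : rat, x ord0 i - d < ratr q < x ord0 i + d.
  have [|q] := @rat_in_itvoo R (x ord0 i - d) (x ord0 i + d); first by lra.
  by rewrite in_itv; exists q.
exists (\row_i q i); rewrite (le_trans (@euclidean_dist_le _ _ _ _ d _ _))//.
- exact: ltW.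
- by move=> i; rewrite !mxE ler_norml; have := qP i; lra.
- by rewrite mulrCA ger_pMr// ler_pdivrMr ?ltr0n// mul1r ler_nat.
Qed.

(** * Extraction of a norm *)

Section tangent_metrics.
Variables (R : realType) (m n : nat) (L : R) (L0 : 0 < L).
Variables (F : set_system nat) (UF : UltraFilter F) (Foo : \oo `<=` F).
Local Notation V := 'rV[R]_m.
Local Notation e := (@euclidean_dist R m).
Implicit Types (rho : V -> V -> R) (C : set (V -> V -> R)).

Definition model_metric rho := [/\
  forall x y, rho x y = rho y x,
  forall y x z, rho x z <= rho x y + rho y z,
  forall x y, L^-1 * e x y <= rho x y <= L * e x y &
  hyperbolic_fun n 0 rho].

(** Small [t] zooms in at [z], while t = 1 translates [z] to the origin. *)
Definition rescaling (z : V) (t : R) rho : V -> V -> R :=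
  fun x y => t^-1 * rho (z + t *: x) (z + t *: y).

(** Limits are taken along the fixed ultrafilter [F], for which bounded sequences always converge,
    so such a [C] behaves like a compact set. Membership for [F]-almost all [k] suffices, which
    allows diagonal sequences. *)
Definition tangent_closed C := [/\ C !=set0, C `<=` model_metric,
  forall rho z t, C rho -> 0 < t -> C (rescaling z t rho) &
  forall (rho_ : nat -> V -> V -> R) rho, (\forall k \near F, C (rho_ k)) ->
    (forall x y, rho_ k x y @[k --> F] --> rho x y) -> C rho].

Lemma model_metricxx rho x : model_metric rho -> rho x x = 0.
Proof.
move=> [_ _ /(_ x x) + _]; rewrite euclidean_distxx !mulr0 -eq_le.
by move/eqP.
Qed.

Lemma model_metric_ge0 rho x y : model_metric rho -> 0 <= rho x y.
Proof.
move=> [_ _ /(_ x y)/andP[+ _] _]; apply: le_trans.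
by rewrite mulr_ge0 ?invr_ge0 ?sqrtr_ge0// ltW.
Qed.

Lemma model_metric_cvg (rho_ : nat -> V -> V -> R) :
  (\forall k \near F, model_metric (rho_ k)) ->
  exists rho, forall x y, rho_ k x y @[k --> F] --> rho x y.
Proof.
move=> model; exists (fun x y => lim (rho_ k x y @[k --> F])) => x y.
apply: (@ultra_bounded_cvg _ _ _ _ _ (L * e x y)).
apply: filterS model => k rhok.
rewrite ger0_norm ?model_metric_ge0//.
by case: rhok => _ _ /(_ x y)/andP[].
Qed.

(** The conditions are scale invariant, as delta = 0, and closed under pointwise limits. *)
Lemma tangent_closed_model : model_metric !=set0 -> tangent_closed model_metric.
Proof.
move=> model0; split=> // [rho z t [sym tri bnd hyp] t0|rho_ rho model rhoF].
  split=> [x y|y x w|x y|x]; rewrite /rescaling.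
  - by rewrite sym.
  - by rewrite -mulrDr ler_wpM2l ?invr_ge0 ?(ltW t0).
  - have := bnd (z + t *: x) (z + t *: y).
    rewrite euclidean_dist_affine gtr0_norm// !(mulrCA _ t).
    by rewrite ler_pdivlMl// ler_pdivrMl.
  - have [alpha alphaN le_alpha] := hyp (fun i => z + t *: x i).
    exists alpha => //; rewrite mulr0 addr0 -!mulr_sumr.
    by rewrite ler_wpM2l ?invr_ge0 ?(ltW t0)// (le_trans le_alpha)// mulr0 addr0.
split=> [x y|y x z|x y|].
- have rho_le x' y' : rho x' y' <= rho y' x'.
    apply: (ler_cvg_to (rhoF x' y') (rhoF y' x')).
    by apply: filterS model => k [sym _ _ _]; rewrite sym.
  by apply/eqP; rewrite eq_le !rho_le.
- apply: (ler_cvg_to (rhoF x z) (cvgD (rhoF x y) (rhoF y z))).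
  by apply: filterS model => k [_ tri _ _]; exact: tri.
- apply/andP; split.
    apply: (ler_cvg_to (cvg_cst (L^-1 * e x y)) (rhoF x y)).
    by apply: filterS model => k [_ _ /(_ x y)/andP[]].
  apply: (ler_cvg_to (rhoF x y) (cvg_cst (L * e x y))).
  by apply: filterS model => k [_ _ /(_ x y)/andP[]].
- apply: (@hyperbolic_fun_cvg _ _ _ F _ (fun=> V) rho_ (fun=> 0)).
  + by apply: filterS model => k [].
  + exact: cvg_cst.
  + by move=> x; exists (fun=> x) => i j; exact: rhoF.
Qed.

Lemma tangent_closed_limit C (rho_ : nat -> V -> V -> R) :
  tangent_closed C -> (\forall k \near F, C (rho_ k)) ->
  exists2 rho, C rho & forall x y, rho_ k x y @[k --> F] --> rho x y.
Proof.
move=> [_ Cmodel _ Climit] Crho_.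
have [rho rhoF] : exists rho, forall x y, rho_ k x y @[k --> F] --> rho x y.
  by apply: model_metric_cvg; apply: filterS Crho_ => k; exact: Cmodel.
by exists rho => //; exact: Climit Crho_ rhoF.
Qed.

Definition line_speed (v : V) (s : R) : set (V -> V -> R) :=
  [set rho | forall x t, rho x (x + t *: v) = s * `|t|].

Lemma cvg_near_cst_eq (u : nat -> R) (l c : R) :
  (\forall k \near F, u k = c) -> u k @[k --> F] --> l -> l = c.
Proof.
by move=> uc ul; apply: (cvg_unique (@Rhausdorff R) ul); exact: cvg_near_cst.
Qed.

Definition speed_bound C (v : V) (s : R) :=
  forall rho x t, C rho -> rho x (x + t *: v) <= s * `|t|.

(** By closure under [rescaling], a bound on [rho 0 v] over all of [C] bounds the speed along [v]
    everywhere; the supremum is attained by compactness. *)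
Lemma max_speed C v : tangent_closed C ->
  exists s, speed_bound C v s /\ exists2 rho, C rho & rho 0 v = s.
Proof.
move=> Cclosed; have [[rho0 Crho0] Cmodel Cresc _] := Cclosed.
pose A : set R := [set rho 0 v | rho in C].
have supA : has_sup A.
  split; first by exists (rho0 0 v), rho0.
  exists (L * e 0 v) => _ [rho /Cmodel[_ _ bnd _] <-].
  by case/andP: (bnd 0 v).
have /choice[rho_ rho_P] (k : nat) :
    exists rho, C rho /\ sup A - k.+1%:R^-1 < rho 0 v.
  have [|_ [rho Crho <-] lt_rho] := @sup_adherent _ A k.+1%:R^-1 _ supA.
    by rewrite invr_gt0 ltr0n.
  by exists rho.
have bound rho : C rho -> rho 0 v <= sup A.
  by move=> Crho; apply: (sup_upper_bound supA); exists rho.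
exists (sup A); split.
  move=> rho x t Crho.
  have pos y u : 0 < u -> rho y (y + u *: v) <= sup A * u.
    move=> u0; have := bound _ (Cresc _ y u Crho u0).
    by rewrite /rescaling scaler0 addr0 mulrC ler_pdivrMr.
  have [t0|t0|->] := ltrgt0P t.
  - by rewrite pos.
  - have [sym _ _ _] := Cmodel _ Crho.
    have := pos (x + t *: v) (- t); rewrite scaleNr addrK sym; apply.
    by rewrite oppr_gt0.
  - by rewrite scale0r addr0 (model_metricxx _ (Cmodel _ Crho)) mulr0.
have [|rho Crho rhoF] := @tangent_closed_limit C rho_ Cclosed.
  by apply: filterE => k; case: (rho_P k).
exists rho => //; apply/eqP; rewrite eq_le bound//=.
have cvgA : sup A - k.+1%:R^-1 @[k --> F] --> sup A - 0.
  apply: cvgB; first exact: cvg_cst.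
  by apply: cvg_trans (@cvg_harmonic R); exact: cvg_app.
rewrite -[sup A]subr0; apply: (ler_cvg_to cvgA (rhoF 0 v)).
by apply: filterE => k; apply: ltW; case: (rho_P k).
Qed.

(* Since v is a direction of maximal speed, all subsegments of the segment
   [0, v] realise this speed; blowing up at 0 makes the segment a ray. *)
Lemma max_speed_ray C v s : tangent_closed C -> speed_bound C v s ->
  (exists2 rho, C rho & rho 0 v = s) ->
  exists2 rho, C rho &
    forall a b, 0 <= a <= b -> rho (a *: v) (b *: v) = s * (b - a).
Proof.
move=> Cclosed smax [rho Crho rho0v].
have [_ Cmodel Cresc _] := Cclosed; have [_ tri _ _] := Cmodel _ Crho.
(* The three pieces of [0, v] cut at [a *: v] and [b *: v] have at most the maximal length each, and
   together at least [s]; so equality holds for each. *)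
have segment a b : 0 <= a <= b -> b <= 1 ->
    rho (a *: v) (b *: v) = s * (b - a).
  move=> /andP[a0 ab] b1.
  have := smax rho 0 a Crho; rewrite add0r ger0_norm//.
  have := smax rho (b *: v) (1 - b) Crho.
  rewrite -scalerDl addrC subrK scale1r ger0_norm ?subr_ge0//.
  have := smax rho (a *: v) (b - a) Crho.
  rewrite -scalerDl addrC subrK ger0_norm ?subr_ge0//.
  have := tri (a *: v) 0 v; have := tri (b *: v) (a *: v) v; rewrite rho0v.
  by move=> *; apply/eqP; rewrite eq_le; apply/andP; split; lra.
(* This zoom stretches [0, v] to [0, (k + 1) v], so every pair of points on the ray is eventually
   covered, with an exact value of the distance. *)
pose rho_ (k : nat) := rescaling 0 k.+1%:R^-1 rho.
have [|rho' Crho' rhoF] := @tangent_closed_limit C rho_ Cclosed.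
  by apply: filterE => k; apply: Cresc; rewrite // invr_gt0 ltr0n.
exists rho' => // a b /andP[a0 ab].
apply: cvg_near_cst_eq (rhoF _ _); apply: Foo.
near=> k; rewrite /rho_ /rescaling !add0r !scalerA segment.
- by rewrite invrK -mulrBr mulrCA mulVKf// pnatr_eq0.
- by rewrite mulr_ge0 ?invr_ge0//= ler_wpM2l ?invr_ge0.
- rewrite ler_pdivrMl ?ltr0n// mulr1 (@le_trans _ _ k%:R) ?ler_nat//.
  near: k; exact: nbhs_infty_ger.
Unshelve. all: end_near. Qed.

(* Along a half-line parallel to the ray, the deficit of the distance with
   respect to maximal speed is nondecreasing and bounded; hence it disappears
   when translating to infinity along the ray. *)
Lemma max_speed_lines C v s : tangent_closed C -> speed_bound C v s ->
  (exists2 rho, C rho &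
    forall a b, 0 <= a <= b -> rho (a *: v) (b *: v) = s * (b - a)) ->
  C `&` line_speed v s !=set0.
Proof.
move=> Cclosed smax [rho Crho ray].
have [_ Cmodel Cresc _] := Cclosed; have [sym tri bnd _] := Cmodel _ Crho.
pose deficit x b := s * b - rho x (x + b *: v).
have deficit_diff x a b : a <= b ->
    s * (b - a) - rho (x + a *: v) (x + b *: v) <= deficit x b - deficit x a.
  rewrite /deficit => ab.
  by have := tri (x + a *: v) x (x + b *: v); lra.
have deficit_mono x a b : a <= b -> deficit x a <= deficit x b.
  move=> ab; have := deficit_diff x a b ab.
  have := smax rho (x + a *: v) (b - a) Crho.
  rewrite -addrA -scalerDl (addrC a) subrK ger0_norm ?subr_ge0//; lra.
(* Going from 0 to [b *: v] through [x] and [x + b *: v] takes at least the length [s * b] of the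
   ray, and the two detours are bounded independently of [b]. *)
have deficit_bound x b : 0 <= b -> deficit x b <= L * e 0 x + L * e x 0.
  move=> b0; rewrite /deficit.
  have := ray 0 b; rewrite lexx b0 subr0 scale0r => /(_ isT) <-.
  have := tri x 0 (b *: v); have := tri (x + b *: v) x (b *: v).
  have /andP[_] := bnd 0 x; have /andP[_] := bnd (x + b *: v) (b *: v).
  have -> : e (x + b *: v) (b *: v) = e x 0.
    have := euclidean_dist_affine 1 (b *: v) x 0.
    by rewrite !scale1r addr0 normr1 mul1r addrC.
  by rewrite (sym x); lra.
(* A bounded monotone function has increments over a fixed gap tending to 0 at infinity. *)
have deficit_cauchy x a b eps : 0 < eps ->
    \forall k \near F, deficit x (k%:R + b) - deficit x (k%:R + a) <= eps.
  move=> eps0.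
  pose A : set R := [set deficit x c | c in [set c | 0 <= c]].
  have supA : has_sup A.
    split; first by exists (deficit x 0), 0; rewrite /=.
    by exists (L * e 0 x + L * e x 0) => _ [c c0 <-]; exact: deficit_bound.
  have [_ [c c0 <-] ltc] := sup_adherent eps0 supA.
  apply: Foo; near=> k.
  have ck : c <= k%:R + a.
    by rewrite -lerBlDr; near: k; exact: nbhs_infty_ger.
  have bk : 0 <= k%:R + b.
    by rewrite -lerBlDr sub0r; near: k; exact: nbhs_infty_ger.
  have le1 := deficit_mono x _ _ ck.
  have le2 : deficit x (k%:R + b) <= sup A.
    by apply: (sup_upper_bound supA); exists (k%:R + b).
  lra.
pose rho_ (k : nat) := rescaling (k%:R *: v) 1 rho.
have [|rho' Crho' rhoF] := @tangent_closed_limit C rho_ Cclosed.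
  by apply: filterE => k; exact: Cresc.
exists rho'; split=> // x t.
have pos y u : 0 <= u -> rho' y (y + u *: v) = s * u.
  move=> u0; apply/eqP; rewrite eq_le; apply/andP; split.
    by have := smax rho' y u Crho'; rewrite ger0_norm.
  apply/ler_addgt0Pr => eps eps0; rewrite -lerBlDr.
  apply: (ler_cvg_to (cvg_cst (s * u - eps)) (rhoF y (y + u *: v))).
  apply: filterS (deficit_cauchy y 0 u _ eps0) => k.
  have := deficit_diff y (k%:R + 0) (k%:R + u).
  rewrite lerD2l => /(_ u0); rewrite /rho_ /rescaling invr1 mul1r !scale1r.
  rewrite (addrC y (_ *: _)) addr0 (addrC (_ *: v) (y + u *: v)).
  rewrite -(addrA y) -scalerDl (addrC u) => le1 le2.
  by move: le1 le2; lra.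
have [t0|t0] := leP 0 t; first by rewrite pos// ger0_norm.
have [sym' _ _ _] := Cmodel _ Crho'.
have := pos (x + t *: v) (- t); rewrite scaleNr addrK sym' ltr0_norm//; apply.
by rewrite oppr_ge0 ltW.
Unshelve. all: end_near. Qed.

(** Rescalings take lines parallel to [v] to such lines of the same speed, so the smaller class is
    again closed and the next direction can be treated inside it. *)
Lemma tangent_closed_line_speed C v : tangent_closed C ->
  exists s, tangent_closed (C `&` line_speed v s).
Proof.
move=> Cclosed; have [s [smax srho]] := max_speed v Cclosed.
have [_ Cmodel Cresc Clim] := Cclosed; exists s; split.
- exact/max_speed_lines/max_speed_ray.
- by move=> rho [/Cmodel].
- move=> rho z t [Crho line] t0; split; first exact: Cresc.
  move=> x u; rewrite /rescaling scalerDr scalerA addrA line normrM gtr0_norm//.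
  by rewrite mulrCA mulKf// gt_eqF.
- move=> rho_ rho Crho_ rhoF; split.
    by apply: Clim rhoF; apply: filterS Crho_ => k [].
  move=> x u; apply: cvg_near_cst_eq (rhoF _ _).
  by apply: filterS Crho_ => k [_].
Qed.

(** The classes for successive rational directions are nested, and a diagonal sequence has an
    [F]-limit lying in all of them. Density of these directions then makes the limit homogeneous and
    translation invariant. *)
Lemma model_metric_norm : model_metric !=set0 ->
  exists N : V -> R, [/\
    forall x, L^-1 * e 0 x <= N x <= L * e 0 x,
    forall x y, N (x + y) <= N x + N y,
    forall t x, N (t *: x) = `|t| * N x &
    hyperbolic_fun n 0 (fun x y => N (y - x))].
Proof.
(* Enumerates the rational vectors; numbers coding no vector get the harmless direction 0. *)
move=> model0; pose q (k : nat) : V :=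
  if unpickle k is Some r then map_mx ratr (r : 'rV[rat]_m) else 0.
have /choice[next nextP] (Ck : {C | tangent_closed C} * nat) :
    exists C' : {C | tangent_closed C}, sval C' `<=` sval Ck.1 /\
      exists s, sval C' `<=` line_speed (q Ck.2) s.
  case: Ck => -[C Cclosed] k /=.
  have [s Cs] := tangent_closed_line_speed (q k) Cclosed.
  exists (exist _ _ Cs); split; first by move=> rho [].
  by exists s => rho [].
pose C_ := nat_rect (fun=> {C | tangent_closed C})
  (exist _ _ (tangent_closed_model model0)) (fun k D => next (D, k)).
have C_decr j k : (j <= k)%N -> sval (C_ k) `<=` sval (C_ j).
  elim: k => [|k IHk]; first by rewrite leqn0 => /eqP ->.
  rewrite leq_eqVlt => /orP[/eqP -> //|/IHk]; apply: subset_trans.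
  by have [] := nextP (C_ k, k).
have /choice[rho_ rho_C] k : exists rho, sval (C_ k) rho.
  by have [/cid[rho ?] _ _ _] := svalP (C_ k); exists rho.
have rho_near j : \forall k \near F, sval (C_ j) (rho_ k).
  apply: Foo; near=> k; apply: (C_decr j k); last exact: rho_C.
  by near: k; exact: nbhs_infty_ge.
have [rho model rhoF] := tangent_closed_limit (svalP (C_ 0%N)) (rho_near 0%N).
have rhoC j : sval (C_ j) rho.
  by have [_ _ _] := svalP (C_ j); apply; [exact: rho_near | exact: rhoF].
have [sym tri bnd hyp] := model.
have rho_q k : exists s, forall x t, rho x (x + t *: q k) = s * `|t|.
  by have [_ [s]] := nextP (C_ k, k); move=> /(_ _ (rhoC k.+1)) sP; exists s.
have approx v eps : 0 < eps -> exists2 w, e w v <= eps &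
    exists s, forall x t, rho x (x + t *: w) = s * `|t|.
  move=> eps0; have [r rv] := rat_row_dense v eps0.
  by exists (map_mx ratr r) => //; have := rho_q (pickle r); rewrite /q pickleK.
have e_shift z x y : e (z + x) (z + y) = e x y.
  have := euclidean_dist_affine 1 z x y.
  by rewrite !scale1r normr1 mul1r.
have e_sym x y : e x y = e y x.
  by congr Num.sqrt; apply: eq_bigr => i _; rewrite -sqrrN opprB.
have rho_close x v w : `|rho x (x + v) - rho x (x + w)| <= L * e w v.
  have := tri (x + w) x (x + v); have := tri (x + v) x (x + w).
  have /andP[_] := bnd (x + w) (x + v); have /andP[_] := bnd (x + v) (x + w).
  by rewrite !e_shift (e_sym v w) ler_norml; lra.
(* The base points [x] and [y] are independent, so this yields homogeneity and, for t = 1,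
   translation invariance. *)
have rho_scale x y t v : rho x (x + t *: v) = `|t| * rho y (y + v).
  apply/eqP; rewrite -subr_eq0 -normr_le0; apply/ler_addgt0Pr => eps eps0.
  (* Replacing [v] by [w] costs [L] |t| eps / [M] twice; the summand 1 keeps [M] positive for t =
     0. *)
  rewrite add0r; pose M := L * (2 * `|t| + 1).
  have M0 : 0 < M by rewrite mulr_gt0// ltr_wpDl// mulr_ge0.
  have [w wv [s sP]] := approx v (eps / M) (divr_gt0 eps0 M0).
  have -> : rho x (x + t *: v) - `|t| * rho y (y + v) =
      (rho x (x + t *: v) - rho x (x + t *: w)) +
      `|t| * (rho y (y + w) - rho y (y + v)).
    have := sP y 1; rewrite scale1r normr1 mulr1 => ->; rewrite sP; ring.
  have close1 : `|rho x (x + t *: v) - rho x (x + t *: w)| <= L * (`|t| * (eps / M)).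
    rewrite (le_trans (rho_close _ _ _))// ler_pM2l//.
    have := euclidean_dist_affine t 0 w v; rewrite !add0r => ->.
    by rewrite ler_wpM2l.
  have close2 : `|rho y (y + w) - rho y (y + v)| <= L * (eps / M).
    by rewrite distrC (le_trans (rho_close _ _ _))// ler_pM2l.
  rewrite (le_trans (ler_normD _ _))// normrM normr_id.
  have epsM : eps = M * (eps / M) by rewrite mulrC divfK// gt_eqF.
  have /(ler_wpM2l (normr_ge0 t)) := close2; move: close1.
  have : 0 <= L * (eps / M) by rewrite mulr_ge0 ?divr_ge0 ?ltW.
  rewrite [X in _ -> _ -> _ -> _ <= X]epsM /M; lra.
have rho_shift x v : rho x (x + v) = rho 0 v.
  by have := rho_scale x 0 1 v; rewrite scale1r normr1 mul1r add0r.
exists (rho 0); split.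
- exact: bnd.
- by move=> x y; rewrite -(rho_shift x y).
- by move=> t x; have := rho_scale 0 0 t x; rewrite !add0r.
- move=> x; have [alpha alphaN le_alpha] := hyp x; exists alpha => //.
  have rhoB i j : rho 0 (x j - x i) = rho (x i) (x j).
    by rewrite -(rho_shift (x i)) addrC subrK.
  by under eq_bigr do rewrite rhoB; under [X in _ <= X + _]eq_bigr do rewrite rhoB.
Unshelve. all: end_near. Qed.

End tangent_metrics.

Lemma cvg_big_sum (R : realType) (I : Type) (s : seq I) (T : Type)
    (F : set_system T) (FF : Filter F) (f : I -> T -> R) (l : I -> R) :
  (forall i, f i t @[t --> F] --> l i) ->
  \sum_(i <- s) f i t @[t --> F] --> \sum_(i <- s) l i.
Proof.
move=> fl; elim: s => [|i s IHs].
  by rewrite big_nil; under eq_fun do rewrite big_nil; exact: cvg_cst.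
by rewrite big_cons; under eq_fun do rewrite big_cons; exact: cvgD.
Qed.

(** * Normed spaces *)

Section norm_not_hyperbolic.
Variables (R : realType) (m n : nat) (L : R) (N : 'rV[R]_m -> R).
Hypotheses (L0 : 0 < L) (nm : (n < m)%N).
Local Notation V := 'rV[R]_m.
Local Notation e := (@euclidean_dist R m).
Hypothesis N_bounds : forall x, L^-1 * e 0 x <= N x <= L * e 0 x.
Hypothesis ND : forall x y, N (x + y) <= N x + N y.
Hypothesis NZ : forall t x, N (t *: x) = `|t| * N x.
Implicit Types x y u w c h : V.

Let dot x y : R := \sum_i x ord0 i * y ord0 i.

Let dotC x y : dot x y = dot y x.
Proof. by apply: eq_bigr => i _; rewrite mulrC. Qed.

Let dotDl x y h : dot (x + y) h = dot x h + dot y h.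
Proof. by rewrite -big_split; apply: eq_bigr => i _; rewrite !mxE mulrDl. Qed.

Let dotZl t x y : dot (t *: x) y = t * dot x y.
Proof. by rewrite mulr_sumr; apply: eq_bigr => i _; rewrite !mxE mulrA. Qed.

Let dotDr h x y : dot h (x + y) = dot h x + dot h y.
Proof. by rewrite !(dotC h) dotDl. Qed.

Let dotZr t x y : dot x (t *: y) = t * dot x y.
Proof. by rewrite !(dotC x) dotZl. Qed.

Let dotNl x y : dot (- x) y = - dot x y.
Proof. by rewrite -scaleN1r dotZl mulN1r. Qed.

Let dotNr x y : dot x (- y) = - dot x y.
Proof. by rewrite !(dotC x) dotNl. Qed.

Let dot0l y : dot 0 y = 0.
Proof. by apply: big1 => i _; rewrite mxE mul0r. Qed.

Let dot_ge0 x : 0 <= dot x x.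
Proof. by apply: sumr_ge0 => i _; rewrite -expr2 sqr_ge0. Qed.

Let dot_gt0 x : x != 0 -> 0 < dot x x.
Proof.
rewrite lt_neqAle dot_ge0 andbT; apply: contraNneq => /esym/eqP dot0.
apply/eqP/rowP => i; rewrite mxE; move: dot0.
rewrite /dot psumr_eq0; last by move=> j _; rewrite -expr2 sqr_ge0.
by move/allP/(_ i (mem_index_enum _)); rewrite -expr2 sqrf_eq0 => /eqP.
Qed.

Let e0E x : e 0 x = Num.sqrt (dot x x).
Proof. by congr Num.sqrt; apply: eq_bigr => i _; rewrite mxE sub0r sqrrN. Qed.

Let N_gt0 x : x != 0 -> 0 < N x.
Proof.
move=> x0; have /andP[+ _] := N_bounds x; apply: lt_le_trans.
by rewrite mulr_gt0 ?invr_gt0// e0E sqrtr_gt0 dot_gt0.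
Qed.

Let NN x : N (- x) = N x.
Proof. by rewrite -scaleN1r NZ normrN1 mul1r. Qed.

Let N_continuous : continuous N.
Proof.
move=> x; have Fx : Filter (nbhs (x : V)) by exact: nbhs_filter.
apply/(@cvgrPdist_le _ _ _ _ Fx) => eps eps0.
pose d := eps / (L * m.+1%:R).
have d0 : 0 < d by rewrite divr_gt0// mulr_gt0.
have : \forall y \near nbhs x, forall i, `|x ord0 i - (y : V) ord0 i| <= d.
  apply: filter_forall => i.
  have /(@cvgrPdist_le _ _ _ _ Fx) : (y : V) ord0 i @[y --> x] --> x ord0 i.
    exact: coord_continuous.
  exact.
apply: filterS => y xyd.
have Le u w : e 0 (u - w) <= m%:R * d -> N u - N w <= eps.
  move=> uwd; have := ND (u - w) w; rewrite subrK.
  have /andP[_ Nuw] := N_bounds (u - w).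
  suff : L * e 0 (u - w) <= eps by lra.
  rewrite (le_trans (ler_wpM2l (ltW L0) uwd))//.
  have -> : L * (m%:R * d) = eps * (L * m%:R / (L * m.+1%:R)) by rewrite /d; ring.
  by rewrite ger_pMr// ler_pdivrMr ?mulr_gt0// mul1r ler_pM2l// ler_nat.
have ed u w : (forall i, `|u ord0 i - w ord0 i| <= d) -> e 0 (u - w) <= m%:R * d.
  move=> uwd; apply: euclidean_dist_le; first exact: ltW.
  by move=> i; rewrite !mxE sub0r normrN.
have le1 : N x - N y <= eps by exact/Le/ed.
have le2 : N y - N x <= eps by apply/Le/ed => i; rewrite distrC.
by rewrite ler_norml; lra.
Qed.

Let paraboloid c y := N y - dot (y - c) (y - c).

Let paraboloid_continuous c : continuous (paraboloid c).
Proof.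
move=> x; have Fx : Filter (nbhs (x : V)) by exact: nbhs_filter.
have coordB i : ((y : V) - c) ord0 i @[y --> x] --> (x - c) ord0 i.
  under eq_fun do rewrite !mxE; rewrite !mxE.
  by apply: cvgB; [exact: coord_continuous | exact: cvg_cst].
have dotB : dot (y - c) (y - c) @[y --> (x : V)] --> dot (x - c) (x - c).
  by apply: cvg_big_sum => i; apply: cvgM.
exact: (cvgB (@N_continuous x) dotB).
Qed.

(** [N] grows at most linearly away from [c], with slope [L], so outside the cube of half-side [L]
    around [c] the quadratic term brings the value below that at [c]; on the compact cube a maximum
    exists. *)
Let paraboloid_max c : exists x, forall y, paraboloid c y <= paraboloid c x.
Proof.
pose A : set V := [set y | forall i, `[c ord0 i - L, c ord0 i + L]%classic (y ord0 i)].
have cA : compact A.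
  apply: (@rV_compact R m (fun i => `[c ord0 i - L, c ord0 i + L]%classic)) => i.
  exact: segment_compact.
have Ac : A c by move=> i; rewrite /= in_itv/= gerBl lerDl ltW.
have [||x _ xmax] := compact_EVT_max _ cA (f := paraboloid c).
- by exists c.
- by apply: continuous_subspaceT; exact: paraboloid_continuous.
exists x => y; have [Ay|nAy] := pselect (A y).
  by apply: xmax; rewrite inE.
have /(le_trans _) : paraboloid c c <= paraboloid c x by apply: xmax; rewrite inE.
apply; rewrite /paraboloid subrr.
have [i ci] : exists i, L < `|y ord0 i - c ord0 i|.
  apply: contrapT => noi; apply: nAy => i.
  by rewrite /= in_itv/= -ler_distl leNgt; apply/negP => ci; apply: noi; exists i.
pose D := e 0 (y - c).
have D0 : 0 <= D by exact: sqrtr_ge0.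
have DD : dot (y - c) (y - c) = D ^+ 2 by rewrite /D e0E sqr_sqrtr.
have LD : L < D.
  rewrite -(ltr_pXn2r (ltn0Sn 1)) ?nnegrE ?(ltW L0)//.
  rewrite -DD /dot (bigD1 i)//= ltr_wpDr//.
    by apply: sumr_ge0 => j _; rewrite -expr2 sqr_ge0.
  rewrite !mxE -expr2 -[ltRHS]real_normK ?num_real//.
  by rewrite ltr_pXn2r// ?nnegrE// ltW.
have := ND (y - c) c; rewrite subrK; have /andP[_] := N_bounds (y - c).
rewrite DD -/D dot0l expr2.
have : D * L <= D * D by rewrite ler_wpM2l// ltW.
lra.
Qed.

(* The paraboloid touches the graph of N from above at x, so that N is
   differentiable at x with gradient 2u. *)
Definition touches u x := forall h, N (x + h) <= N x + 2 * dot u h + dot h h.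

Lemma touchesN u x : touches u x -> touches (- u) (- x).
Proof.
move=> ux h; have := ux (- h); rewrite -{1}(opprK x) -opprD !NN !dotNr dotNl.
by rewrite dotNl opprK; lra.
Qed.

(** Shift [x] by [- h] and [y] by [h], which fixes the sum. With h = (u - w) / 2 the two touching
    inequalities gain |u - w|^2 / 2 over the triangle inequality. *)
Lemma touches_strict u w x y : touches u x -> touches w y -> u != w ->
  N (x + y) < N x + N y.
Proof.
move=> ux wy uw; pose h := 2^-1 *: (u - w).
have d0 : 0 < dot (u - w) (u - w) by rewrite dot_gt0// subr_eq0.
have := ND (x - h) (y + h); rewrite addrACA addNr addr0.
have := ux (- h); have := wy h.
rewrite !dotNl !dotNr /h !dotZl !dotZr opprK.
have : dot (u - w) (u - w) = dot u (u - w) - dot w (u - w) by rewrite dotDl dotNl.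
by move: d0; lra.
Qed.

(** The maximiser [x] of the paraboloid at [c] lies within [L] of [c]. For u = x - c, Euler's
    relation N x <= 2 u.x gives 2 u.c >= N x - 2 |u|^2 >= N c - |u|^2 >= N c - L^2 > 0. *)
Lemma touches_near c : L ^+ 2 < N c ->
  exists u x, touches u x /\ 0 < dot u c.
Proof.
move=> Lc; have [x xmax] := paraboloid_max c; exists (x - c), x.
have ux : touches (x - c) x.
  move=> h; have := xmax (x + h); rewrite /paraboloid addrAC.
  rewrite [dot (x - c + h) _]dotDl !(dotDr _ (x - c) h) (dotC h (x - c)).
  by lra.
split=> //; set u := x - c in ux *.
(* By homogeneity N (x + t x) = (1 + t) N x; this is compared with the touching inequality for small
   t > 0. *)
have Euler : N x <= 2 * dot u x.
  apply/ler_addgt0Pr => eps eps0.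
  pose t := eps / (dot x x + 1).
  have M0 : 0 < dot x x + 1 by rewrite ltr_wpDl.
  have t0 : 0 < t by rewrite divr_gt0.
  have := ux (t *: x).
  rewrite -[X in N (X + _)]scale1r -scalerDl NZ ger0_norm ?addr_ge0 ?(ltW t0)//.
  rewrite !dotZr dotZl => le1.
  have te : t * dot x x <= eps.
    by rewrite /t mulrAC ler_pdivrMr// ler_pM2l// lerDl.
  rewrite -(ler_pM2l t0); have := ler_wpM2l (ltW t0) te; move: le1; lra.
have xE : x = u + c by rewrite subrK.
pose D := e 0 u; have DD : dot u u = D ^+ 2 by rewrite /D e0E sqr_sqrtr.
have D0 : 0 <= D by exact: sqrtr_ge0.
have Ncx : N c + D ^+ 2 <= N x.
  by have := xmax c; rewrite /paraboloid subrr -/u DD dot0l; lra.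
have NxD : N x <= L * D + N c.
  have /andP[_] := N_bounds u; have := ND u c; rewrite -xE -/D; lra.
have DL : D ^+ 2 <= L ^+ 2.
  have [->|Dneq] := eqVneq D 0; first by rewrite expr0n sqr_ge0.
  have Dgt0 : 0 < D by rewrite lt_neqAle eq_sym Dneq.
  rewrite ler_pXn2r ?nnegrE ?(ltW L0)//.
  by rewrite -(ler_pM2r Dgt0) -expr2; lra.
have : dot u x = D ^+ 2 + dot u c by rewrite [in LHS]xE dotDr DD.
by lra.
Qed.

Lemma orthogonal_exists (k : nat) (u : nat -> V) : (k < m)%N ->
  exists2 c, c != 0 & forall i, (i < k)%N -> dot (u i) c = 0.
Proof.
move=> km; pose A : 'M[R]_(k, m) := \matrix_(i, j) u i ord0 j.
have /rowV0Pn[c /sub_kermxP cA c0] : kermx A^T != 0.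
  rewrite -mxrank_eq0 mxrank_ker mxrank_tr -lt0n subn_gt0.
  exact: leq_ltn_trans (rank_leq_row A) km.
exists c => // i ik; have := congr1 (fun M : 'rV[R]_k => M ord0 (Ordinal ik)) cA.
rewrite !mxE => <-; apply: eq_bigr => j _; rewrite !mxE mulrC; congr (_ * _).
Qed.

(* Choosing the center c of the next paraboloid orthogonal to the previous
   gradients makes the new gradient different from them up to sign. *)
Lemma touching_family (k : nat) : (k <= m)%N ->
  exists u x : nat -> V, (forall i, (i < k)%N -> touches (u i) (x i) /\ u i != 0) /\
    forall i j, (i < j < k)%N -> u i != u j /\ u i != - u j.
Proof.
elim: k => [_|k IHk km].
  by exists (fun=> 0), (fun=> 0); split=> [//|i j]; rewrite ltn0 andbF.
have [u [x [ux uu]]] := IHk (ltnW km).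
have [c0 c0N0 uc0] := orthogonal_exists u km.
have Nc0 := N_gt0 c0N0.
(* Scaled so that [N c = L ^+ 2 + 1], above the threshold of [touches_near]. *)
pose c := ((L ^+ 2 + 1) / N c0) *: c0.
have [|w [y [wy wc]]] := @touches_near c.
  rewrite NZ ger0_norm; last by rewrite divr_ge0 ?(ltW Nc0)// addr_ge0 ?sqr_ge0.
  by rewrite divfK ?gt_eqF// ltrDl.
have uc i : (i < k)%N -> dot (u i) c = 0 by move=> ik; rewrite dotZr uc0 ?mulr0.
pose ext (f : nat -> V) z i := if i == k then z else f i.
have extk f z : ext f z k = z by rewrite /ext eqxx.
have extl f z i : (i < k)%N -> ext f z i = f i by rewrite /ext; case: ltngtP.
exists (ext u w), (ext x y); split=> [i|i j /andP[ij]].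
  rewrite ltnS leq_eqVlt => /orP[/eqP ->|ik].
    rewrite !extk; split=> //; apply: contraTneq wc => ->.
    by rewrite dot0l ltxx.
  by rewrite !extl//; exact: ux.
rewrite ltnS leq_eqVlt => /orP[/eqP jk|jk].
  rewrite jk extk extl -?jk//; split; apply: contraTneq wc => uw.
    by rewrite -uw uc -?jk// ltxx.
  by rewrite -[w]opprK -uw dotNl uc -?jk// oppr0 ltxx.
by rewrite !extl ?(ltn_trans ij)//; apply: uu; rewrite ij.
Qed.

(** In the sum for -id each point counts 2 N(x_i); reindexing one copy by [alpha] turns the terms
    into N(x_alpha(i)) + N(x_i). These dominate the terms for [alpha] by the triangle inequality,
    strictly where alpha(i) is not -i. *)
Lemma norm_not_hyperbolic : ~ hyperbolic_fun n 0 (fun x y => N (y - x)).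
Proof.
have [u [x [ux uu]]] := touching_family nm.
pose sg (f : nat -> V) (i : signed_index n) := if i.1 then f i.2 else - f i.2.
have sgN f i : sg f (sopp i) = - sg f i.
  by rewrite /sg /=; case: (i.1); rewrite //= opprK.
have sgu i : touches (sg u i) (sg x i).
  have [uxi _] := ux _ (ltn_ord i.2).
  by rewrite /sg; case: (i.1) => //; exact: touchesN.
have u_neq (i j : 'I_n.+1) : i != j -> u i != u j /\ u i != - u j.
  move=> ij; case: (ltngtP i j) => [lt_ij|lt_ji|/val_inj eq_ij].
  - by apply: uu; rewrite lt_ij ltn_ord.
  - have [|ji jNi] := uu j i; first by rewrite lt_ji ltn_ord.
    by rewrite eq_sym; split=> //; rewrite -eqr_oppLR eq_sym.
  - by rewrite eq_ij eqxx in ij.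
have u_neqN (i : 'I_n.+1) : u i != - u i.
  have [_ ui0] := ux _ (ltn_ord i).
  by rewrite -addr_eq0 -mulr2n -scaler_nat scaler_eq0 pnatr_eq0.
(* Distinct signed indices have distinct gradients; [u_neqN] settles the two signs of one index. *)
have sg_neq i j : j != sopp i -> sg u j != sg u (sopp i).
  case: i j => [s i] [s' j]; rewrite /sopp xpair_eqE /sg /=.
  have [-> |/u_neq[ji jNi] _] := eqVneq j i.
    by case: s s' => -[]//= _; rewrite ?u_neqN// eq_sym u_neqN.
  by case: s s' => -[]//=; rewrite ?eqr_opp// eqr_oppLR.
move=> /(_ (sg x))[alpha alphaN].
have [i0 i0N] : exists i, alpha i != sopp i.
  apply/existsP; rewrite -negb_forall; apply: contra alphaN => /forallP alphaE.
  by apply/eqP/permP => i; rewrite permE; exact/eqP.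
have strict i j : j != sopp i -> N (sg x j - sg x i) < N (sg x j) + N (sg x i).
  move=> /sg_neq neq; rewrite -sgN -(NN (sg x i)) -sgN.
  exact: touches_strict neq.
rewrite mulr0 addr0; apply/negP; rewrite -ltNge.
have eq1 : \sum_i N (sg x (sopp i) - sg x i) =
    \sum_i (N (sg x (alpha i)) + N (sg x i)).
  have reindex : \sum_i N (sg x i) = \sum_i N (sg x (alpha i)).
    by rewrite [LHS](reindex_perm alpha).
  rewrite big_split/= -reindex.
  rewrite -big_split; apply: eq_bigr => i _.
  by rewrite sgN -opprD NN -mulr2n -scaler_nat NZ ger0_norm// mulr_natl mulr2n.
rewrite eq1 (bigD1 i0)//= [X in _ < X](bigD1 i0)//=.
apply: ltr_leD; first exact: strict.
apply: ler_sum => i _.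
by have := ND (sg x (alpha i)) (- sg x i); rewrite NN.
Qed.

End norm_not_hyperbolic.

(** * Blow-up of sets of positive measure *)

Section grid_covers.
Variables (R : realType) (m : nat).
Local Notation V := 'rV[R]_m.
Implicit Types (A K : set V) (p x y z : V) (l : R).

Definition cube p l : set V := box p (p + const_mx l).

Lemma outer_measure_cubes A (s : seq (V * R)) :
  (forall c, c \in s -> 0 < c.2) ->
  (forall x, A x -> exists2 c, c \in s & cube c.1 c.2 x) ->
  (lebesgue_outer_measure A <= (\sum_(c <- s) c.2 ^+ m)%:E)%E.
Proof.
move=> s_gt0 sA; apply: ereal_inf_lbound.
(* A default for [nth] that is never reached, as the index is restricted to k < size s. *)
pose c0 : V * R := (0, 0).
exists (fun k => (k < size s)%N), (fun k => (nth c0 s k).1),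
  (fun k => (nth c0 s k).1 + const_mx (nth c0 s k).2); split.
  move=> x /sA[c cs cx]; exists (index c s); first by rewrite /= index_mem.
  by rewrite nth_index.
apply/esym/(lim_near_cst (@ereal_hausdorff R)).
near=> k; have sk : (size s <= k)%N by near: k; exact: nbhs_infty_ge.
rewrite -(big_nat_widen 0 (size s) k predT) // sumEFin; congr _%:E.
rewrite [RHS](big_nth c0); apply: eq_big_nat => i /andP[_ si].
rewrite /box_volume (eq_bigr (fun=> (nth c0 s i).2)).
  by rewrite prodr_const card_ord.
move=> j _; rewrite !mxE addrAC subrr add0r max_r//.
by rewrite ltW// s_gt0// mem_nth.
Unshelve. all: end_near. Qed.

Lemma nat_cell (t : R) (k : nat) : 0 < t <= k%:R ->
  exists2 i : 'I_k, i%:R < t & t <= i%:R + 1.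
Proof.
elim: k => [|k IHk] /andP[t0 tk]; first by have := lt_le_trans t0 tk; rewrite ltxx.
have [tk'|kt] := leP t k%:R.
  have [|i it ti] := IHk; first by rewrite t0.
  by exists (widen_ord (leqnSn k) i).
by exists ord_max => //=; rewrite natr1.
Qed.

(** A pair of corner and side, like the entries of the covers, so that subdivision can be
    iterated. *)
Definition cell (k : nat) p l (g : {ffun 'I_m -> 'I_k}) : V * R :=
  (p + (l / k%:R) *: \row_i (g i)%:R, l / k%:R).

Lemma cell_itv (k : nat) p l (g : {ffun 'I_m -> 'I_k}) x i :
  cube (cell p l g).1 (cell p l g).2 x ->
  p ord0 i + l / k%:R * (g i)%:R < x ord0 i <= p ord0 i + l / k%:R * ((g i)%:R + 1).
Proof. by move=> /(_ i); rewrite !mxE mulrDr mulr1 addrA. Qed.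

Lemma cube_cell (k : nat) p l x : (0 < k)%N -> 0 < l -> cube p l x ->
  exists g : {ffun 'I_m -> 'I_k}, cube (cell p l g).1 (cell p l g).2 x.
Proof.
move=> k0 l0 px; pose h := l / k%:R.
have h0 : 0 < h by rewrite divr_gt0// ltr0n.
have /choice[g gP] (i : 'I_m) :
    exists j : 'I_k, h * j%:R < x ord0 i - p ord0 i <= h * (j%:R + 1).
  have [|j jt tj] := @nat_cell ((x ord0 i - p ord0 i) / h) k.
    have := px i; rewrite !mxE => /andP[px0 pxl].
    rewrite divr_gt0 ?subr_gt0//= ler_pdivrMr//.
    by rewrite mulrC divfK ?pnatr_eq0 ?gt_eqF// lerBlDl.
  exists j; rewrite (mulrC h) -ltr_pdivlMr// jt/=.
  by rewrite (mulrC h) -ler_pdivrMr.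
exists (finfun g) => i; rewrite !mxE ffunE /= -/h.
by have := gP i; move=> /andP[? ?]; apply/andP; split; lra.
Qed.

(** Each subdivision discards one of the k^m cells, which multiplies the total volume by (k^m - 1) /
    k^m; this is iterated [j] times in the remaining cells. *)
Lemma sparse_cover (k : nat) K : (0 < k)%N ->
  (forall p l, 0 < l -> exists g : {ffun 'I_m -> 'I_k},
     forall x, K x -> ~ cube (cell p l g).1 (cell p l g).2 x) ->
  forall j p l, 0 < l -> exists s : seq (V * R),
    [/\ forall c, c \in s -> 0 < c.2,
        forall x, K x -> cube p l x -> exists2 c, c \in s & cube c.1 c.2 x &
        \sum_(c <- s) c.2 ^+ m = ((k ^ m).-1%:R / (k ^ m)%:R) ^+ j * l ^+ m].
Proof.
move=> k0 missed; have kR0 : 0 < k%:R :> R by rewrite ltr0n.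
elim=> [|j IHj] p l l0.
  exists [:: (p, l)]; split=> [c|x Kx px|].
  - by rewrite inE => /eqP ->.
  - by exists (p, l); rewrite ?inE.
  - by rewrite big_seq1 expr0 mul1r.
have [g0 g0P] := missed p l l0.
have h0 : 0 < l / k%:R by rewrite divr_gt0.
have /choice[s sP] (g : {ffun 'I_m -> 'I_k}) := IHj (cell p l g).1 _ h0.
exists (flatten [seq s g | g <- enum (predC1 g0)]); split.
- by move=> c /flatten_mapP[g _]; have [+ _ _] := sP g; apply.
- move=> x Kx px; have [|g gx] := @cube_cell k p l x k0 l0; first by [].
  have [_ /(_ x Kx gx)[c cs cx] _] := sP g; exists c => //.
  apply/flatten_mapP; exists g => //; rewrite mem_enum inE/=.
  by apply/eqP => gg0; apply: (g0P x Kx); rewrite -gg0.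
- rewrite big_flatten big_map big_enum/=.
  rewrite (eq_bigr (fun=> ((k ^ m).-1%:R / (k ^ m)%:R) ^+ j * (l / k%:R) ^+ m)).
    rewrite sumr_const cardC1 card_ffun !card_ord exprS -mulr_natl.
    rewrite (expr_div_n l) -natrX; set a := _.-1%:R; set b := (k ^ m)%:R.
    by move: ((a / b) ^+ j) (l ^+ m) => u w; ring.
  by move=> g _; have [_ _] := sP g.
Qed.

Lemma dense_cube (k : nat) K : (0 < m)%N -> (0 < k)%N -> compact K ->
  (0 < lebesgue_outer_measure K)%E ->
  exists p l, 0 < l /\ forall g : {ffun 'I_m -> 'I_k},
    exists2 x, K x & cube (cell p l g).1 (cell p l g).2 x.
Proof.
move=> m0 k0 cK K0; apply: contrapT => nodense.
have missed p l : 0 < l -> exists g : {ffun 'I_m -> 'I_k},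
    forall x, K x -> ~ cube (cell p l g).1 (cell p l g).2 x.
  move=> l0; apply: contrapT => all_met; apply: nodense; exists p, l; split=> // g.
  apply: contrapT => g_missed; apply: all_met; exists g => x Kx gx.
  by apply: g_missed; exists x.
have /choice[M MP] (i : 'I_m) :
    exists M : R, 0 < M /\ forall x, K x -> `|x ord0 i| < M.
  have cKi : compact [set x ord0 i | x in K].
    by apply: continuous_compact cK; apply: continuous_subspaceT; exact: coord_continuous.
  have /ex_strict_bound_gt0[M M0 KM] := compact_bounded cKi.
  by exists M; split=> // x Kx; apply: KM; exists x.
(* A common bound for all coordinates, so that [K] lies in a single cube of side [2 * B]. *)
pose B := 1 + \sum_i M i.
have B0 : 0 < B by rewrite ltr_pwDl// sumr_ge0// => i _; case: (MP i) => /ltW.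
have KB x : K x -> cube (const_mx (- B)) (2 * B) x.
  move=> Kx i; rewrite !mxE; have [Mi0 /(_ x Kx)] := MP i.
  have : M i < B.
    rewrite /B (bigD1 i)//= addrCA ltrDl ltr_pwDl// sumr_ge0// => j _.
    by case: (MP j) => /ltW.
  by rewrite ltr_norml => MB /andP[? ?]; apply/andP; split; lra.
pose theta : R := (k ^ m).-1%:R / (k ^ m)%:R.
have km0 : (0 < k ^ m)%N by rewrite expn_gt0 k0.
have theta1 : `|theta| < 1.
  rewrite ger0_norm ?divr_ge0// ltr_pdivrMr ?ltr0n// mul1r ltr_nat.
  by rewrite prednK.
have Kj j : (lebesgue_outer_measure K <= (theta ^+ j * (2 * B) ^+ m)%:E)%E.
  have [|s [s0 sK <-]] := sparse_cover k0 missed j (const_mx (- B)) (l := 2 * B).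
    by rewrite mulr_gt0.
  by apply: outer_measure_cubes => // x Kx; apply: sK => //; exact: KB.
have cvg0 : (theta ^+ j * (2 * B) ^+ m)%:E @[j --> \oo] --> 0%E.
  apply: cvg_EFin; first exact: filterE.
  rewrite -[X in _ --> X](mul0r ((2 * B) ^+ m)); apply: cvgMr_tmp.
  exact: cvg_expr.
have K_le0 : (lebesgue_outer_measure K <= 0)%E.
  by apply: (cvge_to_ge cvg0); exact: filterE.
by rewrite leNgt K0 in K_le0.
Qed.

(** A cube with [2 * k.+1 ^ 2] cells per side, centred at [q] and rescaled to side [2 * k.+1], has
    cells of side 1 / (k + 1), all met by [K]. *)
Lemma dense_rescaled_points (k : nat) K : (0 < m)%N -> compact K ->
  (0 < lebesgue_outer_measure K)%E ->
  exists (q : V) (sigma : R), 0 < sigma /\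
    forall x, (forall i, `|x ord0 i| < k.+1%:R) ->
      exists2 y, K y &
        forall i, `|sigma^-1 * (y ord0 i - q ord0 i) - x ord0 i| <= k.+1%:R^-1.
Proof.
move=> m0 cK K0.
have [|p [l [l0 dense]]] := @dense_cube (2 * k.+1 ^ 2) K m0 _ cK K0.
  by [].
set a : R := k.+1%:R; have a0 : 0 < a by rewrite ltr0n.
pose sigma := l / (2 * a).
have sigma0 : 0 < sigma by rewrite divr_gt0// mulr_gt0.
have side : l / (2 * k.+1 ^ 2)%:R = sigma / a.
  rewrite natrM natrX -/a /sigma; field; rewrite gt_eqF//.
exists (p + const_mx (l / 2)), sigma; split=> // x xa.
pose z : V := p + const_mx (l / 2) + sigma *: x.
have pz : cube p l z.
  move=> i; rewrite !mxE; have := xa i; rewrite ltr_norml => /andP[xi1 xi2].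
  have sa : sigma * a = l / 2 by rewrite /sigma; field; rewrite gt_eqF.
  have up : sigma * x ord0 i < sigma * a by rewrite ltr_pM2l.
  have lo : sigma * - a < sigma * x ord0 i by rewrite ltr_pM2l.
  by apply/andP; split; lra.
have N0 : (0 < 2 * k.+1 ^ 2)%N by rewrite muln_gt0 expn_gt0.
have [g gz] := cube_cell N0 l0 pz.
have [y Ky gy] := dense g; exists y => // i.
have -> : sigma^-1 * (y ord0 i - (p + const_mx (l / 2)) ord0 i) - x ord0 i =
    sigma^-1 * (y ord0 i - z ord0 i).
  by rewrite !mxE; field; rewrite gt_eqF.
rewrite normrM gtr0_norm ?invr_gt0// ler_pdivrMl// -/a.
have /andP[z1 z2] := cell_itv i gz; have /andP[y1 y2] := cell_itv i gy.
move: z1 z2 y1 y2; rewrite side ler_norml.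
move: (sigma / a) (z ord0 i) (g i)%:R => h zi t *; apply/andP; split; lra.
Qed.

End grid_covers.

(** * The limit metric on R^m *)

Lemma euclidean_dist_cvg (R : realType) (m : nat) (F : set_system nat)
    (FF : Filter F) (u v : nat -> 'rV[R]_m) (x y : 'rV[R]_m) :
  (forall i, u k ord0 i @[k --> F] --> x ord0 i) ->
  (forall i, v k ord0 i @[k --> F] --> y ord0 i) ->
  euclidean_dist (u k) (v k) @[k --> F] --> euclidean_dist x y.
Proof.
move=> ux vy; rewrite /euclidean_dist.
apply: (@cvg_comp _ _ _ _ (@Num.sqrt R)); last exact: sqrt_continuous.
apply: cvg_big_sum => i; rewrite expr2; under eq_fun do rewrite expr2.
by apply: cvgM; apply: cvgB.
Qed.

(** Each [x] is assigned points of [Z] whose rescaled images converge to [x]; the rescaled distances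
    in [Z] between them stay bounded, and their limit along an ultrafilter inherits the constant [L]
    and the hyperbolicity. *)
Lemma bilipschitz_model_metric (R : realType) (m n : nat) (L : R)
    (Z : metricType R) (f : Z -> 'rV[R]_m) :
  (0 < m)%N -> 0 < L -> hyperbolic n 0 Z -> compact (range f) ->
  (0 < lebesgue_outer_measure (range f))%E ->
  (forall z w, L^-1 * mdist z w <= euclidean_dist (f z) (f w) /\
               euclidean_dist (f z) (f w) <= L * mdist z w) ->
  @model_metric R m n L !=set0.
Proof.
move=> m0 L0 hypZ cK K0 f_bilip.
have [F [UF Foo]] := @ultraFilterLemma _ (\oo : set_system nat) _.
have FF : ProperFilter F := @ultra_proper _ _ UF.
have /choice[q qP] (k : nat) := dense_rescaled_points k m0 cK K0.
have /choice[sigma sigmaP] := qP.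
have {}qP (k : nat) (x : 'rV[R]_m) : exists z, (forall i, `|x ord0 i| < k.+1%:R) ->
    forall i, `|(sigma k)^-1 * (f z ord0 i - q k ord0 i) - x ord0 i| <= k.+1%:R^-1.
  have [_ sigmak] := sigmaP k.
  have [xk|nxk] := pselect (forall i, `|x ord0 i| < k.+1%:R).
    by have [_ [z _ <-] zx] := sigmak x xk; exists z.
  (* Far points get an arbitrary point of [Z], here one found for 0; each [x] is far for finitely
     many [k] only. *)
  have [i|_ [z _ _] _] := sigmak 0; first by rewrite mxE normr0.
  by exists z => /nxk.
have /choice[near_pt near_ptP] (kx : nat * 'rV[R]_m) := qP kx.1 kx.2.
pose pt k x := near_pt (k, x).
pose u k x := (sigma k)^-1 *: (f (pt k x) - q k).
have sigma0 k : 0 < sigma k by case: (sigmaP k).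
have u_cvg (x : 'rV[R]_m) i : u k x ord0 i @[k --> F] --> x ord0 i.
  apply/cvgrPdist_le => eps eps0; apply: Foo.
  have large : \forall k \near \oo, forall i, `|x ord0 i| < k.+1%:R.
    apply: filter_forall => j; near=> k.
    rewrite (@lt_trans _ _ (k%:R + 0))//; last by rewrite -natr1 ltrD2l.
    rewrite addr0; near: k; exact: nbhs_infty_gtr.
  near=> k.
  rewrite distrC !mxE (@le_trans _ _ k.+1%:R^-1)//.
    apply: (near_ptP (k, x)); near: k; exact: large.
  near: k; have : \forall k \near \oo, k.+1%:R^-1 < eps.
    exact: near_infty_natSinv_lt (PosNum eps0).
  by apply: filterS => k /ltW.
pose rho_ k x y := (sigma k)^-1 * mdist (pt k x) (pt k y).
have e_u k x y : euclidean_dist (u k x) (u k y) =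
    (sigma k)^-1 * euclidean_dist (f (pt k x)) (f (pt k y)).
  have := euclidean_dist_affine (sigma k)^-1 (- ((sigma k)^-1 *: q k)).
  rewrite gtr0_norm ?invr_gt0// => <-.
  by rewrite /u !scalerBr !(addrC (- _)).
have rho_bounds k x y : L^-1 * rho_ k x y <= euclidean_dist (u k x) (u k y) /\
    euclidean_dist (u k x) (u k y) <= L * rho_ k x y.
  have [le1 le2] := f_bilip (pt k x) (pt k y).
  by rewrite e_u /rho_ !(mulrCA _ (sigma k)^-1) !ler_pM2l ?invr_gt0.
have e_cvg x y : euclidean_dist (u k x) (u k y) @[k --> F] --> euclidean_dist x y.
  by apply: euclidean_dist_cvg => i; exact: u_cvg.
have rho_cvg x y : rho_ k x y @[k --> F] --> lim (rho_ k x y @[k --> F]).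
  (* The distance from [u k x] to [u k y] converges to that from [x] to [y], so it eventually
     exceeds it by at most 1. *)
  apply: (@ultra_bounded_cvg _ _ _ _ _ (L * (euclidean_dist x y + 1))).
  have : \forall k \near F,
      euclidean_dist (u k x) (u k y) <= euclidean_dist x y + 1.
    by apply: (cvgr_le _ (e_cvg x y)); rewrite ltrDl.
  apply: filterS => k e_le.
  rewrite ger0_norm ?mulr_ge0 ?invr_ge0 ?mdist_ge0 ?(ltW (sigma0 k))//.
  have [le1 _] := rho_bounds k x y.
  by rewrite -ler_pdivrMl// (le_trans le1).
exists (fun x y => lim (rho_ k x y @[k --> F])); split.
- move=> x y; rewrite /rho_; under eq_fun do rewrite metric_sym.
  by [].
- move=> y x z; apply: (ler_cvg_to (rho_cvg x z) (cvgD (rho_cvg x y) (rho_cvg y z))).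
  apply: filterE => k; rewrite /rho_ -mulrDr ler_wpM2l ?invr_ge0 ?(ltW (sigma0 k))//.
  exact: metric_triangle.
- move=> x y; apply/andP; split.
    rewrite ler_pdivrMl//.
    apply: (ler_cvg_to (e_cvg x y) (cvgM (cvg_cst L) (rho_cvg x y))).
    by apply: filterE => k; case: (rho_bounds k x y).
  rewrite -ler_pdivrMl//.
  apply: (ler_cvg_to (cvgM (cvg_cst L^-1) (rho_cvg x y)) (e_cvg x y)).
  by apply: filterE => k; case: (rho_bounds k x y).
- apply: (@hyperbolic_fun_cvg _ _ _ F _ (fun=> 'rV[R]_m) rho_ (fun=> 0)).
  + apply: filterE => k x; have [alpha alphaN le_alpha] := hypZ (pt k \o x).
    exists alpha => //; rewrite mulr0 addr0 -!mulr_sumr ler_pM2l ?invr_gt0//.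
    by move: le_alpha; rewrite mulr0 addr0.
  + exact: cvg_cst.
  + by move=> x; exists (fun=> x) => i j; exact: rho_cvg.
Unshelve. all: end_near. Qed.

(** * The bound on the asymptotic rank *)

Lemma asymptotic_rank_le (R : realType) (n : nat) (delta : R)
    (X : nat -> metricType R) :
  (forall k, hyperbolic n delta (X k)) -> (asymptotic_rank X <= n%:R%:E)%E.
Proof.
move=> hyp; apply: ge_ereal_sup => _ [m [Z [K [XZ cK K0 [f [L [L0 fK bilip]]]]]] <-].
rewrite lee_fin ler_nat leqNgt; apply/negP => nm; subst K.
have hypZ := asymptotic_subset_hyperbolic hyp XZ.
have model := bilipschitz_model_metric (leq_ltn_trans (leq0n n) nm) L0 hypZ cK K0 bilip.
have [F [UF Foo]] := @ultraFilterLemma _ (\oo : set_system nat) _.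
have [N [N_bounds ND NZ hypN]] := model_metric_norm L0 UF Foo model.
exact: norm_not_hyperbolic L0 nm N_bounds ND NZ hypN.
Qed.

Theorem proposition2p7 (R : realType) (n : nat) :
  (forall (delta : R) (X : nat -> metricType R),
    0 <= delta -> (forall k, hyperbolic n delta (X k)) ->
    [/\ forall Z : metricType R, asymptotic_subset X Z -> hyperbolic n 0 Z,
        forall (F : set_system nat) (UF : UltraFilter F)
               (r : nat -> {posnum R}) (p : forall k, X k),
          (forall k, F <> principal_filter k) ->
          (r k)%:num @[k --> \oo] --> +oo ->
          hyperbolic n 0 (asymptotic_cone UF X r p)
      & (asymptotic_rank X <= n%:R%:E)%E]) /\
  (forall X : metricType R, star_hyperbolic n X -> (asrk X <= n%:R%:E)%E).
Proof.
split=> [delta X _ hyp|X [delta _ hyp]]; last first.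
  exact: (@asymptotic_rank_le _ _ delta).
split=> [Z|F UF r p Fnp roo|].
- exact: asymptotic_subset_hyperbolic.
- exact: asymptotic_cone_hyperbolic.
- exact: asymptotic_rank_le.
Qed.
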